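(* Let $\Gamma$ be a distance-regular graph with diameter $D\geq 3$, vertex set $X$, Bose–Mesner algebra $\mathbf{M}$, and fix a vertex $x\in X$ with Terwilliger algebra $\mathbf{T}=\mathbf{T}(x)$. Let $v$ be a nonzero vector in $E^*_1V$ which is orthogonal to $s_1$, and set $(\mathbf{M};v):=\{P\in \mathbf{M}\mid Pv\in E^*_DV\}$ (a subspace of $\mathbf{M}$). Then the following are equivalent: (i) $(\mathbf{M};v)$ has dimension at least $2$; (ii) $v$ is contained in a thin irreducible $\mathbf{T}$-module with endpoint $1$. Moreover, if (i) and (ii) hold, then $(\mathbf{M};v)$ has dimension exactly $2$.
   Context: $\Gamma=(X,R)$ is a finite, undirected, connected graph without loops or multiple edges, with path-length distance $\partial$ and diameter $D=\max\{\partial(y,z)\}$; it is distance-regular, i.e. for all $0\le h,i,j\le D$ and all $y,z\in X$ with $\partial(y,z)=h$ the number $p^h_{ij}=|\{w\in X:\partial(y,w)=i,\partial(w,z)=j\}|$ depends only on $h,i,j$. For $0\le i\le D$, $A_i\in \mathrm{Mat}_X(\mathbb{C})$ is the $i$th distance matrix ($yz$-entry $1$ if $\partial(y,z)=i$, else $0$), $A=A_1$ is the adjacency matrix, and $\mathbf{M}$ is the subalgebra of $\mathrm{Mat}_X(\mathbb{C})$ generated by $A$ (it has basis $A_0,\dots,A_D$). $V=\mathbb{C}^X$ (column vectors) with Hermitian inner product $\langle u,w\rangle=u^t\overline{w}$; $\hat y$ denotes the standard basis vector for $y\in X$. For $0\le i\le D$, $E^*_i$ is the diagonal matrix with $yy$-entry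 $1$ if $\partial(x,y)=i$ and $0$ otherwise, and $s_i=\sum_{y:\partial(x,y)=i}\hat y$. $\mathbf{T}$ is the subalgebra of $\mathrm{Mat}_X(\mathbb{C})$ generated by $A,E^*_0,\dots,E^*_D$. A $\mathbf{T}$-module is a subspace $W\subseteq V$ with $\mathbf{T}W\subseteq W$; it is irreducible if $W\ne 0$ and its only submodules are $0$ and $W$. The endpoint of an irreducible module $W$ is $\min\{i: E^*_iW\neq 0\}$; $W$ is thin if $\dim E^*_iW\le 1$ for all $0\le i\le D$. *)

(* Defs.v *)
From HB Require Import structures.
From mathcomp Require Import all_boot all_order all_algebra all_field.
From mathcomp Require Import reals complex.

Set Implicit Arguments.
Unset Strict Implicit.
Unset Printing Implicit Defensive.

Import Order.TTheory GRing.Theory Num.Theory.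
Local Open Scope ring_scope.

Section Graph.

Variables (X : finType) (e : rel X).

Definition walk (y z : X) (k : nat) : bool :=
  [exists p : k.-tuple X, path e y p && (last y p == z)].

(* Two vertices joined by a walk are joined by one of length < #|X|, so the   *)
(* search range is exhaustive; the value is #|X| when there is no walk.       *)
Definition gdist (y z : X) : nat := find (walk y z) (iota 0 #|X|).

Definition diam : nat := (\max_(y : X) \max_(z : X) gdist y z)%N.

Record distance_regular : Prop := DistanceRegular {
  drg_sym : symmetric e;
  drg_irr : irreflexive e;
  drg_conn : forall y z, connect e y z;
  drg_inter : exists p : nat -> nat -> nat -> nat,
    forall h i j, (h <= diam)%N -> (i <= diam)%N -> (j <= diam)%N ->
    forall y z, gdist y z = h ->
      #|[set w | (gdist y w == i) && (gdist w z == j)]| = p h i j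
}.

Lemma walkP y z k :
  reflect (exists p : seq X, [/\ size p = k, path e y p & last y p = z])
          (walk y z k).
Proof.
apply: (iffP existsP) => [[p /andP[pp /eqP lp]]|[p [sp pp lp]]].
  by exists p; rewrite size_tuple.
by move/eqP: sp => sp; exists (Tuple sp); rewrite /= pp lp eqxx.
Qed.

Lemma gdist_walk y z : connect e y z -> walk y z (gdist y z).
Proof.
move=> /connectP[p pp ->]; case/shortenP: pp => q pq uq _.
have ltq : (size q < #|X|)%N by rewrite -[X in (X <= _)%N](card_uniqP uq) max_card.
have hw : has (walk y (last y q)) (iota 0 #|X|).
  apply/hasP; exists (size q); first by rewrite mem_iota.
  by apply/walkP; exists q.
by have := nth_find 0%N hw; rewrite nth_iota // -[X in (_ < X)%N](size_iota 0) -has_find.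
Qed.

Lemma gdist_min y z p : path e y p -> last y p = z -> (gdist y z <= size p)%N.
Proof.
move=> pp lp; rewrite leqNgt; apply/negP => lt_p.
have lt_pX : (size p < #|X|)%N.
  by apply: leq_trans lt_p _; rewrite -[X in (_ <= X)%N](size_iota 0) find_size.
have := before_find 0%N lt_p; rewrite nth_iota // add0n.
by move/walkP; apply; exists p.
Qed.

End Graph.

Section MatrixAlgebra.

Variable F : fieldType.

(* The unital subalgebra of 'M_n generated by a sequence of matrices. The     *)
(* library's agenv needs a nontrivial ring, hence the case n = 0, where 'M_0  *)
(* is the zero space.                                                         *)
Definition mxagen (n : nat) : seq 'M[F]_n -> {vspace 'M[F]_n} :=
  match n with
  | 0 => fun=> fullv
  | n'.+1 => fun S => agenv <<S : seq 'M[F]_n'.+1>>%VS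
  end.

Definition mx_subalg n (U : {vspace 'M[F]_n}) : Prop :=
  1%:M \in U /\ forall B C, B \in U -> C \in U -> B *m C \in U.

Lemma mxagen_subalg n (S : seq 'M[F]_n) : mx_subalg (mxagen S).
Proof.
case: n S => [|n] S; first by split=> *; exact: memvf.
split=> [|B C BU CU] /=; first by rewrite memvE sub1_agenv.
by have := memv_mul BU CU; rewrite agenvM.
Qed.

Lemma mem_mxagen n (S : seq 'M[F]_n) : {subset S <= mxagen S}.
Proof.
case: n S => [|n] S B BS; first exact: memvf.
exact: (subvP (sub_agenv _)) (memv_span BS).
Qed.

Lemma mxagen_min n (S : seq 'M[F]_n) (U : {vspace 'M[F]_n}) :
  mx_subalg U -> {subset S <= U} -> (mxagen S <= U)%VS.
Proof.
case: n S U => [|n] S U [U1 UM] SU.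
  by apply/subvP=> B _; rewrite [B]flatmx0 mem0v.
apply: agenv_sub_modl; first by rewrite -memvE.
apply/prodvP=> B C BS CU; apply: UM => //.
by apply: subvP BS; apply/span_subvP.
Qed.

Definition mximg n (B : 'M[F]_n) (W : {vspace 'cV[F]_n}) : {vspace 'cV[F]_n} :=
  (linfun (mulmx B) @: W)%VS.

Lemma mximgP n (B : 'M[F]_n) (W : {vspace 'cV[F]_n}) w :
  reflect (exists2 u, u \in W & w = B *m u) (w \in mximg B W).
Proof.
by apply: (iffP memv_imgP) => -[u uW ->]; exists u; rewrite ?lfunE.
Qed.

End MatrixAlgebra.

Section Terwilliger.

(* Matrices and vectors indexed by X are indexed by 'I_#|X| through           *)
(* enum_val / enum_rank.                                                      *)
Variables (F : fieldType) (X : finType) (e : rel X).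

Definition dist_mx (i : nat) : 'M[F]_#|X| :=
  \matrix_(p, q) (gdist e (enum_val p) (enum_val q) == i)%:R.

Definition bose_mesner : {vspace 'M[F]_#|X|} := mxagen [:: dist_mx 1].

Definition hat (y : X) : 'cV[F]_#|X| := delta_mx (enum_rank y) 0.

Variable x : X.

Definition Estar (i : nat) : 'M[F]_#|X| :=
  diag_mx (\row_p (gdist e x (enum_val p) == i)%:R).

Definition EstarV (i : nat) : {vspace 'cV[F]_#|X|} := mximg (Estar i) fullv.

Definition svec (i : nat) : 'cV[F]_#|X| := \sum_(y | gdist e x y == i) hat y.

Definition terwilliger : {vspace 'M[F]_#|X|} :=
  mxagen (dist_mx 1 :: [seq Estar i | i <- iota 0 (diam e).+1]).

Definition Tmodule (W : {vspace 'cV[F]_#|X|}) : Prop :=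
  forall B w, B \in terwilliger -> w \in W -> B *m w \in W.

Definition Tirreducible (W : {vspace 'cV[F]_#|X|}) : Prop :=
  [/\ Tmodule W, W <> 0%VS &
      forall U : {vspace 'cV[F]_#|X|},
        Tmodule U -> (U <= W)%VS -> U = 0%VS \/ U = W].

(* The value is D + 1 when no E*_i W is nonzero, i.e. when W = 0.             *)
Definition endpoint (W : {vspace 'cV[F]_#|X|}) : nat :=
  find (fun i => mximg (Estar i) W != 0%VS) (iota 0 (diam e).+1).

Definition thin (W : {vspace 'cV[F]_#|X|}) : Prop :=
  forall i, (i <= diam e)%N -> (\dim (mximg (Estar i) W) <= 1)%N.

Definition in_thin_irreducible (r : nat) (v : 'cV[F]_#|X|) : Prop :=
  exists W : {vspace 'cV[F]_#|X|},
    [/\ Tirreducible W, thin W, endpoint W = r & v \in W].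

(* The space (M; v) of all P in M with P v in E*_D V.                         *)
Definition bm_pair (v : 'cV[F]_#|X|) : {vspace 'M[F]_#|X|} :=
  (bose_mesner :&: linfun (mulmxr v) @^-1: EstarV (diam e))%VS.

Lemma mem_bm_pair v P :
  (P \in bm_pair v) = (P \in bose_mesner) && (P *m v \in EstarV (diam e)).
Proof. by rewrite memv_cap -memv_preim lfunE. Qed.

End Terwilliger.

Definition hdot (C : numClosedFieldType) n (u w : 'cV[C]_n) : C :=
  (u^T *m map_mx Num.conj w) 0 0.

(* Main.v *)
Require Import Defs.
From HB Require Import structures.
From mathcomp Require Import all_boot all_order all_algebra all_field.
From mathcomp Require Import reals complex zify.
Import Order.TTheory GRing.Theory Num.Theory.
Local Open Scope ring_scope.

(* Write A_j for the distance matrices and E_i for the dual idempotents, and    *)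
(* put u_i = E_i A_(i-1) v and w_i = E_i A_(i+1) v. Since v is supported on the *)
(* neighbours of x and has zero sum, E_i A_j v vanishes for |i - j| > 1 and     *)
(* E_i A_i v = - (u_i + w_i). Hence P = sum_j al_j A_j maps v into E_D V iff    *)
(*   (al_(i+1) - al_i) w_i = (al_i - al_(i-1)) u_i   for 0 < i < D.             *)
(* Both (i) and (ii) are equivalent to: u_i <> 0 and w_i is a multiple of u_i   *)
(* for 0 < i < D. Given that, the equations determine al up to the constant     *)
(* sequences and one scalar, so (M; v) has dimension 2, and u_1, ..., u_D span  *)
(* a thin T-module, irreducible because A and the E_i are self-adjoint. The     *)
(* u_i cannot vanish early: if w_j is a multiple of u_j for all j <= k and      *)
(* u_(k+1) = 0, then u_1, ..., u_k span an A-stable space containing v; for     *)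
(* k <= D - 2 this gives A_D v = 0, and then the E_1-components of              *)
(* A_(D-2) A_D v and A_(D-1) A_D v force v = 0.                                 *)

(** Both conditions pass through [upvec_chain]. From (i): [mem_bm_pair_coef] turns membership in (M;
    v) into equations between consecutive increments of the coefficients. A nonconstant solution
    puts each w_i on the line of u_i ([upvec_chain_of_dim]): where an increment vanishes, the first
    nonzero one comes later, the equation there gives a zero w, and zeros of w propagate downwards
    ([downvec_eq0]). From (ii): thinness puts u_i and w_i on one line ([upvec_chain_of_thin]).
    Nonvanishing of u_i is automatic ([upvec_chain_ind]), since an early zero would close up an
    A-stable space that is too short to contain a nonzero A_D v ([upspace_diam],
    [dist_mx_diam_vec_eq0]). Conversely, the chain makes the increments obey a first-order
    recurrence with a one-parameter solution space ([dim_of_upvec_chain]), and makes the span of the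
    u_i a thin module ([adj_upspace], [thin_of_upvec_chain]) with no proper nonzero submodule
    ([upspace_irreducible]). *)

Section GraphDistance.
Set Implicit Arguments.
Unset Strict Implicit.

Variables (X : finType) (e : rel X).
Hypothesis hdrg : distance_regular e.
Local Notation d := (gdist e).
Local Notation D := (diam e).

Lemma gdist_pathP y z :
  exists p, [/\ size p = d y z, path e y p & last y p = z].
Proof. exact/walkP/gdist_walk/(drg_conn hdrg). Qed.

Lemma gdist_le_path y p : path e y p -> (d y (last y p) <= size p)%N.
Proof. by move=> pp; apply: gdist_min. Qed.

Lemma gdist_triangle y w z : (d y z <= d y w + d w z)%N.
Proof.
have [p [<- pp lp]] := gdist_pathP y w; have [q [<- pq lq]] := gdist_pathP w z.
by rewrite -size_cat; apply: gdist_min; rewrite ?cat_path ?last_cat lp ?pp.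
Qed.

Lemma gdist_sym y z : d y z = d z y.
Proof.
suff le a b : (d a b <= d b a)%N by apply/eqP; rewrite eqn_leq !le.
have [p [<- pp <-]] := gdist_pathP b a.
rewrite -(size_belast b) -size_rev; apply: gdist_min.
  rewrite rev_path (eq_path (e' := e)) // => u w; exact: (drg_sym hdrg).
case: p {pp} => //= c p; by rewrite rev_cons last_rcons.
Qed.

Lemma gdist_eq0 y z : (d y z == 0%N) = (y == z).
Proof.
apply/eqP/eqP => [d0 | ->].
  by have [p [/eqP]] := gdist_pathP y z; rewrite d0 => /nilP -> _ /= ->.
by apply/eqP; rewrite -leqn0; apply: (@gdist_min _ e z z [::]).
Qed.

Lemma gdist_le_diam y z : (d y z <= D)%N.
Proof.
apply: leq_trans (leq_bigmax (F := fun y => \max_(z : X) gdist e y z)%N y).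
exact: (leq_bigmax (F := gdist e y) z).
Qed.

(** The witness is the i-th vertex of a geodesic; both halves are at most as long as they should be,
    and the triangle inequality forces equality. *)
Lemma gdist_between y z i : (i <= d y z)%N ->
  exists w, d y w = i /\ d w z = (d y z - i)%N.
Proof.
move=> ile; have [p [sp pp lp]] := gdist_pathP y z.
exists (last y (take i p)).
move: pp; rewrite -{1}(cat_take_drop i p) cat_path => /andP[p1 p2].
have l1 := gdist_le_path p1; have l2 := gdist_le_path p2.
move: l1 l2; rewrite -last_cat cat_take_drop lp size_drop sp.
rewrite size_takel ?sp // => l1 l2.
have := gdist_triangle y (last y (take i p)) z.
set a := d _ _ in l1 *; set b := d _ z in l2 * => tr.
have b_eq : b = (d y z - i)%N.
  apply/eqP; rewrite eqn_leq l2 leq_subLR /=.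
  by apply: leq_trans tr _; rewrite leq_add2r.
split=> //; apply/eqP; rewrite eqn_leq l1 /=.
by move: tr; rewrite b_eq addnC -leq_subLR subKn.
Qed.

Lemma gdist_attained (x : X) h : (h <= D)%N -> exists y z, d y z = h.
Proof.
move=> hD; have X0 : (0 < #|X|)%N by apply/card_gt0P; exists x.
have [y Hy] := bigop.eq_bigmax (fun y => \max_(z : X) gdist e y z)%N X0.
have [z Hz] := bigop.eq_bigmax (gdist e y) X0.
have dyz : d y z = D by rewrite -Hz -Hy.
have [|w [dw _]] := @gdist_between y z h; first by rewrite dyz.
by exists y, w.
Qed.

Variable p : nat -> nat -> nat -> nat.
Hypothesis hp : forall h i j, (h <= D)%N -> (i <= D)%N -> (j <= D)%N ->
    forall y z, gdist e y z = h ->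
      #|[set w | (gdist e y w == i) && (gdist e w z == j)]| = p h i j.

Lemma inter_triangle (x : X) h i j : (h <= D)%N -> (i <= D)%N -> (j <= D)%N ->
  p h i j != 0%N -> [&& h <= i + j, i <= h + j & j <= h + i]%N.
Proof.
move=> hD iD jD; have [y [z dyz]] := gdist_attained x hD.
rewrite -(hp hD iD jD dyz) -lt0n => /card_gt0P[w].
rewrite inE => /andP[/eqP <- /eqP <-]; rewrite -dyz.
have := gdist_triangle y w z; have := gdist_triangle y z w.
have := gdist_triangle w y z; rewrite (gdist_sym w y) (gdist_sym z w); lia.
Qed.

(** Degenerate triangles are realised by three points on one geodesic of the longest of the three
    lengths, and any length up to the diameter occurs. *)
Lemma inter_neq0 (x : X) h i j : (h <= D)%N -> (i <= D)%N -> (j <= D)%N ->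
  (h = i + j \/ j = h + i)%N -> p h i j != 0%N.
Proof.
move=> hD iD jD eqs.
have [y [z [w [dyz dyw dwz]]]] : exists y z w, [/\ d y z = h, d y w = i & d w z = j].
  case: eqs => eqs.
    have [y [z dyz]] := gdist_attained x hD.
    have [|w [dyw dwz]] := @gdist_between y z i; first by rewrite dyz eqs leq_addr.
    by exists y, z, w; rewrite dwz dyz eqs addKn.
  have [w [z dwz]] := gdist_attained x jD.
  have [|y [dwy dyz]] := @gdist_between w z i; first by rewrite dwz eqs leq_addl.
  by exists y, z, w; rewrite (gdist_sym y w) dwy dyz dwz eqs addnK.
rewrite -(hp hD iD jD dyz) -lt0n; apply/card_gt0P; exists w.
by rewrite inE dyw dwz !eqxx.
Qed.

End GraphDistance.

(** * Stable subspaces, short sums and the Hermitian product *)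

Lemma mxagen_stable (F : fieldType) n (S : seq 'M[F]_n) (W : {vspace 'cV[F]_n}) :
  (forall B w, B \in S -> w \in W -> B *m w \in W) ->
  forall B w, B \in mxagen S -> w \in W -> B *m w \in W.
Proof.
(* [U] is the algebra of matrices preserving W; testing on a basis of W presents it as a vector
   space, so that [mxagen_min] applies. *)
move=> SW; pose U := (\bigcap_(i < \dim W) (linfun (mulmxr (vbasis W)`_i) @^-1: W))%VS.
have UP B : reflect (forall w, w \in W -> B *m w \in W) (B \in U).
  apply: (iffP idP) => [|BW].
    rewrite memvE => /subv_bigcapP BU w wW; rewrite (coord_vbasis wW) mulmx_sumr.
    apply: memv_suml => i _; rewrite -scalemxAr memvZ //.
    by have := BU i isT; rewrite -memvE -memv_preim lfunE.
  rewrite memvE; apply/subv_bigcapP => i _; rewrite -memvE -memv_preim lfunE /=.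
  by apply/BW/vbasis_mem/mem_nth; rewrite size_tuple.
have UM : mx_subalg U.
  split=> [|B B' /UP BW /UP BW']; first by apply/UP => w; rewrite mul1mx.
  by apply/UP => w wW; rewrite -mulmxA BW ?BW'.
have SU : {subset S <= U} by move=> B BS; apply/UP => w; apply: SW.
by move=> B w /(subvP (mxagen_min UM SU))/UP; apply.
Qed.

Lemma sum_three (V : nmodType) (G : nat -> V) i N : (i.+2 < N)%N ->
  (forall j, (j < i)%N || (i.+2 < j)%N -> G j = 0) ->
  \sum_(j < N) G j = G i + G i.+1 + G i.+2.
Proof.
move=> iN G0; rewrite -(big_mkord xpredT G).
rewrite (@big_cat_nat _ _ _ i) //=; last by lia.
rewrite (@big_cat_nat _ _ _ i.+3 i) //=; last by lia.
rewrite [X in _ + (X + _)]big_nat_recr ?leqW //=.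
rewrite [X in _ + (X + _ + _)]big_nat_recr ?leqW //= big_nat1.
rewrite [X in X + _]big_nat [X in X + _]big1 => [|j /andP[_ ji]]; last by rewrite G0 ?ji.
by rewrite add0r big_nat big1 ?addr0 // => j /andP[ij _]; rewrite G0 // ij orbT.
Qed.

Lemma hdot_suml (C : numClosedFieldType) n I (r : seq I) (f : I -> 'cV[C]_n) w :
  hdot (\sum_(i <- r) f i) w = \sum_(i <- r) hdot (f i) w.
Proof. by rewrite /hdot raddf_sum mulmx_suml summxE. Qed.

Lemma hdotZl (C : numClosedFieldType) n c (a b : 'cV[C]_n) : 
  hdot (c *: a) b = c * hdot a b.
Proof. by rewrite /hdot linearZ -scalemxAl mxE. Qed.

Lemma hdot_eq0 (C : numClosedFieldType) n (w : 'cV[C]_n) : hdot w w = 0 -> w = 0.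
Proof.
rewrite /hdot mxE => /eqP; rewrite psumr_eq0 => [/allP w0|q _]; last first.
  by rewrite !mxE mul_conjC_ge0.
apply/colP => q; have := w0 q (mem_index_enum q).
by rewrite !mxE mul_conjC_eq0 => /eqP.
Qed.

Lemma hdot_adjoint (C : numClosedFieldType) n (B : 'M[C]_n) a b :
  B^T = B -> map_mx Num.conj B = B ->
  hdot (B *m a) b = hdot a (B *m b).
Proof. by move=> BT BC; rewrite /hdot trmx_mul BT map_mxM BC mulmxA. Qed.

(** * Distance matrices, dual idempotents and the Bose-Mesner algebra *)

Section DistanceMatrices.
Set Implicit Arguments.
Unset Strict Implicit.

Variables (C : numClosedFieldType) (X : finType) (e : rel X).
Hypothesis hdrg : distance_regular e.
Variable x : X.
Local Notation d := (gdist e).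
Local Notation D := (diam e).
Local Notation A := (dist_mx C e).
Local Notation E := (Estar C e x).

Lemma cV_hatP (u w : 'cV[C]_#|X|) :
  (forall z, u (enum_rank z) 0 = w (enum_rank z) 0) -> u = w.
Proof. by move=> H; apply/colP => q; rewrite -(enum_valK q). Qed.

Lemma mul_dist_mxE j (w : 'cV[C]_#|X|) z :
  (A j *m w) (enum_rank z) 0 = \sum_y (d z y == j)%:R * w (enum_rank y) 0.
Proof.
rewrite mxE (reindex (@enum_rank X)) /=; last exact/onW_bij/enum_rank_bij.
by apply: eq_bigr => y _; rewrite mxE !enum_rankK.
Qed.

Lemma mul_EstarE i (w : 'cV[C]_#|X|) z :
  (E i *m w) (enum_rank z) 0 = (d x z == i)%:R * w (enum_rank z) 0.
Proof. by rewrite mul_diag_mx !mxE enum_rankK. Qed.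

Lemma dist_mx0 : A 0 = 1%:M.
Proof. by apply/matrixP=> q r; rewrite !mxE gdist_eq0 // (inj_eq enum_val_inj). Qed.

Lemma dist_mx_gt_diam j : (D < j)%N -> A j = 0.
Proof.
move=> Dj; apply/matrixP=> q r; rewrite !mxE.
have := gdist_le_diam e (enum_val q) (enum_val r); case: eqP => [dj le|_ _ //].
by move: le; rewrite dj leqNgt Dj.
Qed.

Lemma Estar_gt_diam i : (D < i)%N -> E i = 0.
Proof.
move=> Di; apply/matrixP=> q r; rewrite !mxE.
have := gdist_le_diam e x (enum_val q); case: eqP => [->|_ _]; last exact: mul0rn.
by rewrite leqNgt Di.
Qed.

Lemma Estar_mul i j (w : 'cV[C]_#|X|) :
  E i *m (E j *m w) = if i == j then E i *m w else 0.
Proof.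
apply: cV_hatP => z; rewrite !mul_EstarE.
rewrite mulrA -natrM mulnb; case: (i =P j) => [<-|ij]; first by rewrite andbb mul_EstarE.
by case: andP => [[/eqP -> /eqP] //|_]; rewrite mul0r mxE.
Qed.

Lemma Estar_id i (w : 'cV[C]_#|X|) : E i *m (E i *m w) = E i *m w.
Proof. by rewrite Estar_mul eqxx. Qed.

Lemma sum_Estar (w : 'cV[C]_#|X|) : w = \sum_(i < D.+1) E i *m w.
Proof.
apply: cV_hatP => z; rewrite summxE.
rewrite (bigD1 (Ordinal (gdist_le_diam e x z : d x z < D.+1)%N)) //=.
rewrite mul_EstarE eqxx mul1r.
rewrite big1 ?addr0 // => i /eqP ni; rewrite mul_EstarE.
case: eqP; rewrite ?mul0r // => eqi; by case: ni; apply: val_inj.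
Qed.

Lemma mem_EstarV i w : (w \in EstarV C e x i) = (E i *m w == w).
Proof.
apply/mximgP/eqP => [[u _ ->]|<-]; first exact: Estar_id.
by exists w; rewrite ?memvf.
Qed.

Lemma Estar_dist_mx_eq0 i j k (w : 'cV[C]_#|X|) :
  ~~ [&& i <= j + k, j <= i + k & k <= i + j]%N ->
  E i *m (A j *m (E k *m w)) = 0.
Proof.
move=> nt; apply: cV_hatP => z; rewrite mul_EstarE mul_dist_mxE mxE.
case: eqP; rewrite ?mul0r // mul1r => dxz; apply: big1 => y _.
case: eqP; rewrite ?mul0r // mul1r => dzy; rewrite mul_EstarE.
case: eqP; rewrite ?mul0r // mul1r => dxy.
have t1 := gdist_triangle hdrg x y z; have t2 := gdist_triangle hdrg x z y.
have t3 := gdist_triangle hdrg z x y.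
rewrite (gdist_sym hdrg y z) (gdist_sym hdrg z x) in t1 t3; lia.
Qed.

Lemma Estar_mul_adj i (w : 'cV[C]_#|X|) : E i.+1 *m (A 1 *m w) =
  E i.+1 *m (A 1 *m (E i *m w)) + E i.+1 *m (A 1 *m (E i.+1 *m w)) +
  E i.+1 *m (A 1 *m (E i.+2 *m w)).
Proof.
apply: cV_hatP => z; rewrite [RHS]mxE [X in _ = X + _]mxE !mul_EstarE -!mulrDr.
case: eqP; rewrite ?mul0r // !mul1r => dxz.
rewrite !mul_dist_mxE -!big_split; apply: eq_bigr => y _ /=.
rewrite !mul_EstarE -!mulrDr -!mulrDl; case: eqP; rewrite ?mul0r // !mul1r => dzy.
have t1 := gdist_triangle hdrg x y z; have t2 := gdist_triangle hdrg x z y.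
rewrite (gdist_sym hdrg y z) in t1.
have : [|| d x y == i, d x y == i.+1 | d x y == i.+2] by lia.
by case/or3P => /eqP ->; rewrite !(eqn_leq, ltnn, leqnSn, ltnNge, leqnn, leqW, ltnW) /=
  ?mul1r ?addr0 ?add0r ?mul1r.
Qed.

Section Products.

Variable p : nat -> nat -> nat -> nat.
Hypothesis hp : forall h i j, (h <= D)%N -> (i <= D)%N -> (j <= D)%N ->
    forall y z, gdist e y z = h ->
      #|[set w | (gdist e y w == i) && (gdist e w z == j)]| = p h i j.

Lemma dist_mx_mulE i j q r : (i <= D)%N -> (j <= D)%N ->
  (A i *m A j) q r = (p (d (enum_val q) (enum_val r)) i j)%:R.
Proof.
move=> iD jD; rewrite -(hp _ iD jD (erefl _)) ?gdist_le_diam //.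
rewrite mxE (reindex (@enum_rank X)) /=; last exact/onW_bij/enum_rank_bij.
rewrite -[X in _ = X%:R]sum1_card natr_sum [RHS]big_mkcond /=.
apply: eq_bigr => y _; rewrite !mxE enum_rankK inE.
by case: eqP; case: eqP; rewrite ?mulr0 ?mul0r ?mulr1.
Qed.

Lemma dist_mx_mul i j : (i <= D)%N -> (j <= D)%N ->
  A i *m A j = \sum_(h < D.+1) (p h i j)%:R *: A h.
Proof.
move=> iD jD; apply/matrixP=> q r; rewrite dist_mx_mulE // summxE.
have dD := gdist_le_diam e (enum_val q) (enum_val r).
rewrite (bigD1 (Ordinal (dD : _ < D.+1)%N)) //= !mxE eqxx mulr1.
rewrite big1 ?addr0 // => h /eqP nh; rewrite !mxE; case: eqP; rewrite ?mulr0 // => eqh.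
by case: nh; apply: val_inj.
Qed.

(** The triangle inequality leaves three terms. For j + 1 = D the last one is zero, as [A j.+2]
    vanishes beyond the diameter. *)
Lemma dist_mx_rec j : (j < D)%N ->
  A 1 *m A j.+1 = (p j 1 j.+1)%:R *: A j + (p j.+1 1 j.+1)%:R *: A j.+1
                  + (p j.+2 1 j.+1)%:R *: A j.+2.
Proof.
move=> jD; apply/matrixP=> q r; rewrite dist_mx_mulE ?(leq_ltn_trans _ jD) // !mxE.
set k := d _ _; have kD : (k <= D)%N by apply: gdist_le_diam.
have jD1 : (1 <= D)%N by lia.
have tri := inter_triangle hdrg hp x kD jD1 jD.
have [/or3P K|] := boolP [|| k == j, k == j.+1 | k == j.+2].
  by case: K => /eqP ->; rewrite !(eqn_leq, ltnn, leqnSn, ltnNge, leqnn, leqW, ltnW) /=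
    ?mulr1 ?mulr0 ?addr0 ?add0r.
case/norP => nj /norP[nj1 nj2].
rewrite (negbTE nj) (negbTE nj1) (negbTE nj2) !mulr0 !addr0.
by case: (p k 1 j.+1 =P 0%N) => [-> //|/eqP/tri]; lia.
Qed.

End Products.

Lemma dist_mx_bm j : A j \in bose_mesner C e.
Proof.
have [p hp] := drg_inter hdrg.
have [M1 MM] := mxagen_subalg [:: A 1].
have A1 : A 1 \in bose_mesner C e by apply: mem_mxagen; rewrite inE.
suff: A j \in bose_mesner C e /\ A j.+1 \in bose_mesner C e by case.
elim: j => [|j [Aj Aj1]]; first by rewrite dist_mx0; split.
split=> //; have [Dj|jD] := ltnP D j.+2; first by rewrite dist_mx_gt_diam ?mem0v.
(* The leading coefficient of the recurrence is nonzero, so [A j.+2] can be solved for. *)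
have c0 : (p j.+2 1%N j.+1)%:R != 0 :> C.
  by rewrite pnatr_eq0; apply: (inter_neq0 hdrg hp x) => //; lia.
have := dist_mx_rec hp (ltnW jD).
move/(congr1 (fun B => (p j.+2 1 j.+1)%:R^-1 *:
  (B - (p j 1 j.+1)%:R *: A j - (p j.+1 1 j.+1)%:R *: A j.+1))) => /=.
rewrite [X in _ = _ *: X](_ : _ = (p j.+2 1 j.+1)%:R *: A j.+2); last first.
  by rewrite -addrA -opprD addrC addKr.
rewrite scalerA mulVf // scale1r => <-.
by rewrite memvZ // !memvB ?memvZ //; apply: MM.
Qed.

(** The span of the distance matrices is itself an algebra containing A. Coefficients are indexed by
    [nat] so that neighbouring indices can be written freely. *)
Lemma bose_mesnerP P : reflect (exists al : nat -> C, P = \sum_(j < D.+1) al j *: A j)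
  (P \in bose_mesner C e).
Proof.
apply: (iffP idP) => [|[al ->]]; last first.
  by apply: memv_suml => j _; rewrite memvZ ?dist_mx_bm.
have [p hp] := drg_inter hdrg.
pose U := (\sum_(j < D.+1) <[A j]>)%VS.
have AU (j : 'I_D.+1) : A j \in U.
  by apply: (subvP (sumv_sup j _ (subvv _))) => //; apply: memv_line.
have UM : mx_subalg U.
  split; first by rewrite -dist_mx0; apply: (AU ord0).
  move=> B B' /memv_sumP[b bA ->] /memv_sumP[b' bA' ->].
  rewrite mulmx_suml; apply: memv_suml => i _; rewrite mulmx_sumr.
  apply: memv_suml => j _; have /vlineP[k ->] := bA i isT.
  have /vlineP[k' ->] := bA' j isT; rewrite -scalemxAl -scalemxAr.
  rewrite !memvZ // (dist_mx_mul hp) ?(ltn_ord i, ltn_ord j) //.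
  - by apply: memv_suml => h _; rewrite memvZ.
  - by rewrite -ltnS.
  - by rewrite -ltnS.
have SU : {subset [:: A 1] <= U}.
  move=> B; rewrite inE => /eqP ->; have [D1|D0] := leqP 1 D.
    exact: (AU (Ordinal (D1 : 1 < D.+1)%N)).
  by rewrite dist_mx_gt_diam ?mem0v.
move/(subvP (mxagen_min UM SU)) => /memv_sumP[b bA ->].
have /fin_all_exists[al al_b] (j : 'I_D.+1) : exists k, b j = k *: A j.
  exact/vlineP/bA.
exists (fun n => al (inord n)); apply: eq_bigr => j _.
by rewrite al_b inord_val.
Qed.

Lemma sum_dist_mxE (al : nat -> C) y z :
  (\sum_(j < D.+1) al j *: A j) (enum_rank y) (enum_rank z) = al (d y z).
Proof.
have dD : (d y z < D.+1)%N by rewrite ltnS gdist_le_diam.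
rewrite summxE (bigD1 (Ordinal dD)) //= !mxE !enum_rankK eqxx mulr1.
rewrite big1 ?addr0 // => j /eqP nj; rewrite !mxE !enum_rankK.
by case: eqP; rewrite ?mulr0 // => eqj; case: nj; apply: val_inj.
Qed.

Lemma sum_dist_mx_inj (al bl : nat -> C) :
  \sum_(j < D.+1) al j *: A j = \sum_(j < D.+1) bl j *: A j ->
  forall j, (j <= D)%N -> al j = bl j.
Proof.
move=> eqs j /(gdist_attained hdrg x)[y [z <-]].
by rewrite -!sum_dist_mxE eqs.
Qed.

Lemma bm_sub_terwilliger : (bose_mesner C e <= terwilliger C e x)%VS.
Proof.
apply: mxagen_min; first exact: mxagen_subalg.
by move=> B; rewrite inE => /eqP ->; apply: mem_mxagen; rewrite inE eqxx.
Qed.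

Lemma Estar_terwilliger i : E i \in terwilliger C e x.
Proof.
have [iD|Di] := leqP i D; last by rewrite Estar_gt_diam ?mem0v.
by apply: mem_mxagen; rewrite inE map_f ?orbT // mem_iota.
Qed.

Lemma dist_mx_terwilliger j : A j \in terwilliger C e x.
Proof. exact: subvP bm_sub_terwilliger _ (dist_mx_bm j). Qed.

Lemma hdot_dist_mx j a b : hdot (A j *m a) b = hdot a (A j *m b).
Proof.
apply: hdot_adjoint; apply/matrixP => q r; rewrite !mxE ?rmorph_nat //.
by rewrite gdist_sym.
Qed.

Lemma hdot_Estar i a b : hdot (E i *m a) b = hdot a (E i *m b).
Proof.
apply: hdot_adjoint; first exact: tr_diag_mx.
by apply/matrixP => q r; rewrite !mxE rmorphMn /= rmorph_nat.
Qed.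

End DistanceMatrices.

(** * The vectors u_i and w_i attached to v *)

Section EndpointOne.
Set Implicit Arguments.
Unset Strict Implicit.

Variables (C : numClosedFieldType) (X : finType) (e : rel X).
Hypothesis hdrg : distance_regular e.
Variable x : X.
Local Notation d := (gdist e).
Local Notation D := (diam e).
Local Notation A := (dist_mx C e).
Local Notation E := (Estar C e x).

Variable v : 'cV[C]_#|X|.

(** The value 0 at index 0 reflects the convention that the distance matrix of index -1 is zero. *)
Definition upvec i : 'cV[C]_#|X| :=
  if i is n.+1 then E n.+1 *m (A n *m v) else 0.

Definition downvec i : 'cV[C]_#|X| := E i *m (A i.+1 *m v).

Local Notation u := upvec.
Local Notation um := downvec.

Hypothesis Ev : E 1 *m v = v.
Hypothesis sum_v : \sum_y v (enum_rank y) 0 = 0.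

Lemma Estar_upvec i : E i *m u i = u i.
Proof. by case: i => [|i] /=; rewrite ?mulmx0 // Estar_id. Qed.

Lemma upvec1 : u 1 = v.
Proof. by rewrite /= dist_mx0 // mul1mx. Qed.

Lemma Estar_dist_vec_eq0 i j : ~~ [&& i <= j + 1, j <= i + 1 & 1 <= i + j]%N ->
  E i *m (A j *m v) = 0.
Proof. by rewrite -Ev; apply: Estar_dist_mx_eq0. Qed.

Lemma vec_supp y : v (enum_rank y) 0 != 0 -> d x y = 1%N.
Proof.
by rewrite -Ev mul_EstarE; case: (d x y =P 1%N) => // _; rewrite mul0r eqxx.
Qed.

Lemma Estar0_dist_vec j : E 0 *m (A j *m v) = 0.
Proof.
have [->|j1] := eqVneq j 1%N; last by apply: Estar_dist_vec_eq0; lia.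
apply: cV_hatP => z; rewrite mul_EstarE mul_dist_mxE mxE.
case: eqP; rewrite ?mul0r // mul1r => /eqP; rewrite gdist_eq0 // => /eqP <-.
rewrite -[RHS]sum_v; apply: eq_bigr => y _.
have [->|/vec_supp ->] := eqVneq (v (enum_rank y) 0) 0; first by rewrite mulr0.
by rewrite mul1r.
Qed.

(** A vertex at distance i + 1 from x is at distance i, i + 1 or i + 2 from each neighbour of x, so
    its entry in the sum is the total of the entries of v. *)
Lemma Estar_dist_vec_sum i : E i.+1 *m (A i *m v) + E i.+1 *m (A i.+1 *m v) +
  E i.+1 *m (A i.+2 *m v) = 0.
Proof.
rewrite -!mulmxDr; apply: cV_hatP => z.
rewrite mul_EstarE [X in _ * X]mxE [X in _ * (X + _)]mxE !mul_dist_mxE mxE.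
case: eqP; rewrite ?mul0r // mul1r => dxz.
rewrite -[RHS]sum_v -!big_split; apply: eq_bigr => y _ /=; rewrite -!mulrDl.
have [->|/vec_supp dxy] := eqVneq (v (enum_rank y) 0) 0; first by rewrite mulr0.
have t1 := gdist_triangle hdrg x y z; have t2 := gdist_triangle hdrg z x y.
rewrite (gdist_sym hdrg y z) (gdist_sym hdrg z x) in t1 t2.
have : [|| d z y == i, d z y == i.+1 | d z y == i.+2] by lia.
by case/or3P => /eqP ->; rewrite !(eqn_leq, ltnn, leqnSn, ltnNge, leqnn, leqW, ltnW) /=
  ?mul1r ?addr0 ?add0r ?mul1r.
Qed.

Lemma Estar_dist_vec_diag i : E i.+1 *m (A i.+1 *m v) = - (u i.+1 + um i.+1).
Proof.
apply/eqP; rewrite -addr_eq0 addrA [_ + u _]addrC; apply/eqP.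
exact: Estar_dist_vec_sum.
Qed.

Lemma Estar_dist_vec_line i : um i.+1 \in <[u i.+1]>%VS ->
  forall h, E i.+1 *m (A h *m v) \in <[u i.+1]>%VS.
Proof.
move=> um_u h; have [->|n1] := eqVneq h i; first exact: memv_line.
have [->|n2] := eqVneq h i.+1.
  by rewrite Estar_dist_vec_diag memvN memvD ?memv_line.
have [->//|n3] := eqVneq h i.+2.
by rewrite Estar_dist_vec_eq0 ?mem0v //; lia.
Qed.

Lemma bm_vec_line i : (forall h, E i *m (A h *m v) \in <[u i]>%VS) ->
  forall P, P \in bose_mesner C e -> E i *m (P *m v) \in <[u i]>%VS.
Proof.
move=> H P /(bose_mesnerP hdrg x)[al ->]; rewrite mulmx_suml mulmx_sumr.
by apply: memv_suml => j _; rewrite -scalemxAl -scalemxAr memvZ.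
Qed.

(** Level n + 2 of A A_n v sees only level n + 1 of A_n v. In the recurrence for A A_n only the
    A_{n+1} term reaches that level, with a nonzero intersection number as coefficient. *)
Lemma adj_upvec n : exists2 c : C, (n.+1 <= D)%N -> c != 0 &
  E n.+2 *m (A 1 *m u n.+1) = c *: u n.+2.
Proof.
have [p hp] := drg_inter hdrg.
have -> : E n.+2 *m (A 1 *m u n.+1) = E n.+2 *m (A 1 *m (A n *m v)).
  rewrite [RHS]Estar_mul_adj // [E n.+2 *m (A n *m v)]Estar_dist_vec_eq0; last by lia.
  rewrite [E n.+3 *m (A n *m v)]Estar_dist_vec_eq0; last by lia.
  by rewrite !mulmx0 !addr0.
case: n => [|n]; first by exists 1; rewrite ?oner_eq0 // scale1r dist_mx0 // mul1mx.
have [nD|Dn] := ltnP n D; last first.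
  exists 0; first by lia.
  by rewrite [A n.+1]dist_mx_gt_diam // !(mul0mx, mulmx0) scale0r.
exists (p n.+2 1 n.+1)%:R.
  by move=> nD2; rewrite pnatr_eq0; apply: (inter_neq0 hdrg hp x) => //; lia.
rewrite [A 1 *m _]mulmxA (dist_mx_rec C hdrg x hp) //.
rewrite !mulmxDl !mulmxDr -!scalemxAl -!scalemxAr.
rewrite [E n.+3 *m (A n *m v)]Estar_dist_vec_eq0; last by lia.
rewrite [E n.+3 *m (A n.+1 *m v)]Estar_dist_vec_eq0; last by lia.
by rewrite !scaler0 !add0r.
Qed.

Lemma adj_upvec_line i : E i.+1 *m (A 1 *m u i) \in <[u i.+1]>%VS.
Proof.
case: i => [|n]; first by rewrite /u !mulmx0 mem0v.
by have [c _ ->] := adj_upvec n; rewrite memvZ ?memv_line.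
Qed.

(** The lowering counterpart of [adj_upvec]: level i + 1 of A A_{i+3} v sees only w_{i+2}, and
    equals a nonzero multiple of w_{i+1}. *)
Lemma downvec_eq0 i : (i.+2 < D)%N -> um i.+2 = 0 -> um i.+1 = 0.
Proof.
move=> iD um0; have [p hp] := drg_inter hdrg.
have : E i.+1 *m (A 1 *m (A i.+3 *m v)) = 0.
  rewrite Estar_mul_adj // [E i.+2 *m _]um0.
  rewrite [E i *m (A i.+3 *m v)]Estar_dist_vec_eq0; last by lia.
  rewrite [E i.+1 *m (A i.+3 *m v)]Estar_dist_vec_eq0; last by lia.
  by rewrite !mulmx0 !addr0.
rewrite [A 1 *m _]mulmxA (dist_mx_rec C hdrg x hp) //.
rewrite !mulmxDl !mulmxDr -!scalemxAl -!scalemxAr.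
rewrite [E i.+1 *m (A i.+3 *m v)]Estar_dist_vec_eq0; last by lia.
rewrite [E i.+1 *m (A i.+4 *m v)]Estar_dist_vec_eq0; last by lia.
rewrite !scaler0 !addr0 => /eqP; rewrite scaler_eq0 pnatr_eq0 => /orP[|/eqP //].
by apply/contraTeq => _; apply: (inter_neq0 hdrg hp x); lia.
Qed.

Hypothesis hD : (3 <= D)%N.

Lemma dist_mx_diam_vec_eq0 : A D *m v = 0 -> v = 0.
Proof.
move=> ADv; have [p hp] := drg_inter hdrg.
(* Only A_h with h >= i occur in A_{D-i} A_D, and A_i occurs with nonzero coefficient. Used for i =
   2, then i = 1, this leaves only v in [Estar_dist_vec_sum]. *)
have key i : (0 < i < 3)%N -> (forall h, (i < h)%N -> E 1 *m (A h *m v) = 0) ->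
    E 1 *m (A i *m v) = 0.
  move=> i3 Hi; have : E 1 *m (A (D - i) *m (A D *m v)) = 0 by rewrite ADv !mulmx0.
  rewrite [A (D - i) *m _]mulmxA (dist_mx_mul C hp) ?leq_subr // mulmx_suml mulmx_sumr.
  have iD : (i < D.+1)%N by lia.
  rewrite (bigD1 (Ordinal iD)) //= big1 ?addr0 => [|h].
    rewrite -scalemxAl -scalemxAr => /eqP; rewrite scaler_eq0 pnatr_eq0 => /orP[|/eqP //].
    by apply/contraTeq => _; apply: (inter_neq0 hdrg hp x); lia.
  move=> /eqP/val_eqP /= hi; rewrite -scalemxAl -scalemxAr.
  have [ih|] := ltnP i h; first by rewrite Hi // scaler0.
  rewrite leq_eqVlt (negbTE hi) /= => lt_hi.
  case: (p h (D - i)%N D =P 0%N) => [->|/eqP]; first by rewrite scale0r.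
  by move=> /(inter_triangle hdrg hp x); lia.
have E2 : E 1 *m (A 2 *m v) = 0.
  by apply: key => // h h2; apply: Estar_dist_vec_eq0; lia.
have E1 : E 1 *m (A 1 *m v) = 0.
  apply: key => // h h1; have [->//|h2] := eqVneq h 2%N.
  by apply: Estar_dist_vec_eq0; lia.
by have := Estar_dist_vec_sum 0; rewrite E1 E2 !addr0 -/(u 1) upvec1.
Qed.

(** * A-invariance of the span of the u_i *)

Definition upspace k : {vspace 'cV[C]_#|X|} := (\sum_(i < k.+1) <[u i]>)%VS.

Lemma upvec_upspace k i : (i <= k)%N -> u i \in upspace k.
Proof.
move=> ik; have ik' : (i < k.+1)%N by [].
by apply: (subvP (sumv_sup (Ordinal ik') _ (subvv _))) => //; apply: memv_line.
Qed.

Lemma Estar_upspace k i w : w \in upspace k ->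
  E i *m w \in (if (i <= k)%N then <[u i]> else 0)%VS.
Proof.
move=> /memv_sumP[f fu ->]; rewrite mulmx_sumr; apply: memv_suml => j _.
have /vlineP[c ->] := fu j isT; rewrite -scalemxAr memvZ //.
rewrite -(Estar_upvec j) Estar_mul; case: eqP => [ij|_]; last exact: mem0v.
by rewrite ij -ltnS ltn_ord Estar_upvec memv_line.
Qed.

Section Invariant.

Variable k : nat.
Hypothesis Hk : forall i h, (i <= k)%N -> E i *m (A h *m v) \in <[u i]>%VS.
Hypothesis uk : u k.+1 = 0.

Let adj_bm h : A 1 *m A h \in bose_mesner C e.
Proof.
have [_ MM] := mxagen_subalg [:: A 1].
by apply: MM; apply: dist_mx_bm.
Qed.

Let adj_dist_line i h : (i <= k)%N -> E i *m (A 1 *m (A h *m v)) \in <[u i]>%VS.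
Proof. by move=> ik; rewrite [A 1 *m _]mulmxA; apply: bm_vec_line => // j; apply: Hk. Qed.

Let adj_prev_line i h : (i <= k)%N ->
  E i.+1 *m (A 1 *m (E i *m (A h *m v))) \in <[u i.+1]>%VS.
Proof.
move=> ik; have /vlineP[c ->] := Hk h ik.
by rewrite -!scalemxAr memvZ ?adj_upvec_line.
Qed.

Let adj_same_line i : (i <= k)%N -> E i *m (A 1 *m u i) \in <[u i]>%VS.
Proof.
case: i => [|n] nk; first by rewrite /u !mulmx0 mem0v.
(* Split A_n v by levels: the top level is u_{n+1}; the whole and the contribution from level n are
   already on the line, so the remaining term is too. *)
have := Estar_mul_adj hdrg x n (A n *m v).
rewrite [E n.+2 *m (A n *m v)]Estar_dist_vec_eq0; last by lia.
rewrite !mulmx0 addr0 => /(canLR (addKr _)) <-.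
by rewrite memvD ?memvN ?adj_prev_line ?adj_dist_line // ltnW.
Qed.

Let adj_next_line i : (i <= k)%N -> E i *m (A 1 *m u i.+1) \in <[u i]>%VS.
Proof.
case: i => [|n] nk; first by rewrite upvec1 Estar0_dist_vec mem0v.
(* The same splitting for A_{n+1} v, whose top level is u_{n+2} and whose level n + 1 is a multiple
   of u_{n+1}, covered by [adj_same_line]. *)
have := Estar_mul_adj hdrg x n (A n.+1 *m v).
move=> /(canLR (addKr _)) <-.
rewrite memvD ?adj_dist_line // memvN memvD ?adj_prev_line ?(ltnW nk) //.
have /vlineP[c ->] := Hk n.+1 nk.
by rewrite -!scalemxAr memvZ ?adj_same_line.
Qed.

Lemma adj_upspace w : w \in upspace k -> A 1 *m w \in upspace k.
Proof.
move=> /memv_sumP[f fu ->]; rewrite mulmx_sumr; apply: memv_suml => [[i ik]] _.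
have /vlineP[c ->] := fu (Ordinal ik) isT; rewrite -scalemxAr memvZ //= {c f fu}.
rewrite (sum_Estar e x (A 1 *m u i)); apply: memv_suml => j _.
have line_sub l z : (l <= k)%N -> z \in <[u l]>%VS -> z \in upspace k.
  by move=> lk /vlineP[c ->]; rewrite memvZ ?upvec_upspace.
have [ji|n1] := eqVneq (j : nat) i.+1.
  rewrite ji; have := adj_upvec_line i; have [/line_sub|ki] := leqP i.+1 k; first exact.
  have -> : i = k by lia.
  by rewrite uk => /vlineP[c ->]; rewrite scaler0 mem0v.
have [ji|n2] := eqVneq (j : nat) i.
  by rewrite ji; apply: line_sub (adj_same_line _).
have [ji|n3] := eqVneq j.+1 i.
  by rewrite -ji; apply: (line_sub j); [lia | apply: adj_next_line; lia].
by rewrite -(Estar_upvec i) Estar_dist_mx_eq0 ?mem0v //; lia.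
Qed.

Lemma upspace_diam : v != 0 -> (D <= k.+1)%N.
Proof.
move=> v0; rewrite leqNgt; apply/negP => kD.
have k0 : (0 < k)%N.
  by rewrite lt0n; apply: contraNneq v0 => k0; rewrite -upvec1 -uk k0.
case/eqP: v0; apply: dist_mx_diam_vec_eq0.
(* This space lives on levels at most k <= D - 2, whereas A_D v lives on levels D - 1 and D, so A_D
   v = 0. *)
have ADW : A D *m v \in upspace k.
  apply: (@mxagen_stable _ _ [:: A 1]).
  - by move=> B w; rewrite inE => /eqP ->; apply: adj_upspace.
  - exact: dist_mx_bm.
  - by rewrite -upvec1 upvec_upspace.
rewrite (sum_Estar e x (A D *m v)); apply: big1 => j _.
have := Estar_upspace j ADW; case: leqP => [jk _|_]; last by rewrite memv0 => /eqP.
by apply: Estar_dist_vec_eq0; lia.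
Qed.

End Invariant.

(** * The chain condition, dimension 2 and the thin module *)

Hypothesis v0 : v != 0.

Definition upvec_chain := forall i, (i.+1 < D)%N ->
  u i.+1 != 0 /\ um i.+1 \in <[u i.+1]>%VS.

(** If u_{i+1} were the first zero, the lines up to level i would span an A-stable space, and
    [upspace_diam] would give D <= i + 1. *)
Lemma upvec_chain_ind :
  (forall i, (i.+1 < D)%N -> (forall j, (j <= i)%N -> u j.+1 != 0) ->
     um i.+1 \in <[u i.+1]>%VS) -> upvec_chain.
Proof.
move=> H i; elim/ltn_ind: i => i IH iD.
have ui : u i.+1 != 0.
  apply/negP => /eqP ui0; suff : (D <= i.+1)%N by lia.
  apply: upspace_diam => // j h ji; case: j ji => [|j] ji.
    by rewrite Estar0_dist_vec mem0v.
  by apply: Estar_dist_vec_line; apply: (proj2 (IH j _ _)); lia.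
split=> //; apply: H => // j; rewrite leq_eqVlt => /orP[/eqP -> //|ji].
by apply: (proj1 (IH j _ _)); lia.
Qed.

Lemma Estar_bm_vec (al : nat -> C) i : (i.+1 < D)%N ->
  E i.+1 *m ((\sum_(j < D.+1) al j *: A j) *m v) =
  (al i.+2 - al i.+1) *: um i.+1 - (al i.+1 - al i) *: u i.+1.
Proof.
move=> iD; rewrite mulmx_suml mulmx_sumr.
rewrite (@sum_three _ (fun j => E i.+1 *m ((al j *: A j) *m v)) i) ?ltnS //; last first.
  by move=> j nj; rewrite -scalemxAl -scalemxAr Estar_dist_vec_eq0 ?scaler0 //; lia.
rewrite -!scalemxAl -!scalemxAr Estar_dist_vec_diag -/(u i.+1) -/(um i.+1).
by rewrite !scalerBl scalerN scalerDr opprB opprD [RHS]addrC !addrA addrAC.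
Qed.

Lemma downvec_eq0_le m i : (m.+1 < D)%N -> um m.+1 = 0 -> (i <= m)%N -> um i.+1 = 0.
Proof.
elim: m => [|m IH] mD um0; first by rewrite leqn0 => /eqP ->.
rewrite leq_eqVlt => /orP[/eqP -> //|]; rewrite ltnS; apply: IH; first exact: ltnW.
exact: downvec_eq0.
Qed.

Lemma mem_bm_pair_coef (al : nat -> C) :
  (\sum_(j < D.+1) al j *: A j \in bm_pair e x v) <->
  (forall i, (i.+1 < D)%N ->
     (al i.+2 - al i.+1) *: um i.+1 = (al i.+1 - al i) *: u i.+1).
Proof.
have PM : \sum_(j < D.+1) al j *: A j \in bose_mesner C e.
  by apply/bose_mesnerP => //; exists al.
rewrite mem_bm_pair PM mem_EstarV /=; split => [/eqP PD i iD | H].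
  apply/eqP; rewrite -subr_eq0 -Estar_bm_vec // -PD Estar_mul.
  by rewrite (ltn_eqF iD).
apply/eqP; rewrite [RHS](sum_Estar e x) [RHS]big_ord_recr /=.
rewrite [X in _ = X + _]big1 ?add0r // => i _.
case: i => [[|i] iD] /=; last by rewrite Estar_bm_vec // H // subrr.
rewrite mulmx_suml mulmx_sumr big1 // => j _.
by rewrite -scalemxAl -scalemxAr Estar0_dist_vec scaler0.
Qed.

(* The factor 1 lets mem_bm_pair_coef apply with constant coefficients. *)
Definition allone_mx : 'M[C]_#|X| := \sum_(j < D.+1) 1 *: A j.

Lemma upvec_chain_of_dim : (2 <= \dim (bm_pair e x v))%N -> upvec_chain.
Proof.
move=> dim2; have : ~~ (bm_pair e x v <= <[allone_mx]>)%VS.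
  by apply: contraL dim2 => /dimvS le1; rewrite -ltnNge;
    rewrite (leq_ltn_trans le1) // dim_vline ltnS leq_b1.
case/subvPn => P PM; have := PM.
rewrite mem_bm_pair => /andP[/(bose_mesnerP hdrg x)[al eP] _].
rewrite {}eP in PM *; move/mem_bm_pair_coef: PM => H nJ.
have ex_j : exists j, (j < D)%N && (al j.+1 != al j).
  case: (pickP (fun j : 'I_D => al j.+1 != al j)) => [j nj|cst].
    by exists j; rewrite ltn_ord.
  case/negP: nJ; apply/vlineP; exists (al 0%N); rewrite scaler_sumr.
  apply: eq_bigr => [[j jD]] _ /=; rewrite scale1r; congr (_ *: _).
  elim: j jD => // j IH jD; rewrite -IH; last exact: ltnW.
  by apply/eqP/negPn; have := cst (Ordinal (jD : j < D)%N); move=> /= ->.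
apply: upvec_chain_ind => i iD ui.
have [ali|nali] := eqVneq (al i.+2) (al i.+1); last first.
  apply/vlineP; exists ((al i.+2 - al i.+1)^-1 * (al i.+1 - al i)).
  by rewrite -scalerA -H // scalerA mulVf ?scale1r // subr_eq0.
(* Let m be the first jump of [al]. If m > i + 1, the equation at level m gives w_m = 0, hence
   w_{i+1} = 0. Otherwise the jump persists up to i + 1, contradicting [ali]. *)
case: (ex_minnP ex_j) => m /andP[mD nm] min_m.
have [im|mi] := ltnP i.+1 m.
  case: m im mD nm min_m => // m im mD nm min_m.
  apply: (eq_rect_r (fun w => w \in _) (mem0v _)).
  apply: (@downvec_eq0_le m) => //; last by lia.
  have alm : al m.+1 = al m.
    by apply/eqP; apply: contraT => nm'; have := min_m m; rewrite nm' ltnn (ltnW mD); apply.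
  have /eqP := H m mD; rewrite alm subrr scale0r scaler_eq0 subr_eq0 -alm (negbTE nm).
  by move/eqP.
(* Once al jumps it keeps jumping up to i.+1, as the u j.+1 are nonzero. *)
have up j : (m + j <= i.+1)%N -> al ((m + j).+1)%N != al (m + j)%N.
  elim: j => [|j IH]; first by rewrite addn0.
  rewrite !addnS => ji.
  have ji' : (m + j <= i)%N by [].
  apply: contraNneq (IH (ltnW ji)) => eq_al.
  have /eqP := H (m + j)%N (leq_ltn_trans ji iD).
  rewrite eq_al subrr scale0r eq_sym scaler_eq0 (negbTE (ui _ ji')) orbF subr_eq0.
  done.
by have := up (i.+1 - m)%N; rewrite subnKC // ali eqxx => /(_ (leqnn _)).
Qed.

Lemma dim_of_upvec_chain : upvec_chain -> \dim (bm_pair e x v) = 2%N.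
Proof.
move=> chain.
have /fin_all_exists[g0 g0P] (i : 'I_D.+1) :
    exists c, (i.+1 < D)%N -> um i.+1 = c *: u i.+1.
  case: (ltnP i.+1 D) => iD; last by exists 0.
  by have [_ /vlineP[c ->]] := chain i iD; exists c.
pose g n := g0 (inord n).
have gP i : (i.+1 < D)%N -> um i.+1 = g i *: u i.+1.
  by move=> iD; have := g0P (inord i); rewrite inordK; [apply | lia].
(* The increments be solve be i = g i * be i.+1 with be (D - 1) = 1. *)
pose be i := \prod_(i <= j < D.-1) g j; pose al n := \sum_(0 <= i < n) be i.
have beS i : (i.+1 < D)%N -> be i = g i * be i.+1.
  by move=> iD; rewrite /be big_ltn //; lia.
have beD : be D.-1 = 1 by rewrite /be big_geq.
have alS n : al n.+1 - al n = be n.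
  by rewrite /al big_nat_recr //= addrAC subrr add0r.
pose P1 := \sum_(j < D.+1) al j *: A j.
have P1M : P1 \in bm_pair e x v.
  by apply/mem_bm_pair_coef => i iD; rewrite !alS gP // scalerA (beS i iD) mulrC.
have JM : allone_mx \in bm_pair e x v.
  by apply/(mem_bm_pair_coef (fun=> 1)) => i iD; rewrite !subrr !scale0r.
have PJ : P1 \notin <[allone_mx]>%VS.
  apply/vlineP => -[c]; rewrite scaler_sumr.
  under eq_bigr do rewrite scalerA mulr1.
  move/(@sum_dist_mx_inj _ _ _ hdrg x al (fun=> c)) => cst.
  have := alS D.-1; rewrite prednK ?cst ?leqnn ?leq_pred ?beD; [|lia..].
  by move/eqP; rewrite subrr eq_sym oner_eq0.
have J0 : allone_mx != 0.
  apply/eqP => J0; have := @sum_dist_mx_inj C _ _ hdrg x (fun=> 1) (fun=> 0).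
  rewrite -/allone_mx J0 big1 => [/(_ erefl 0%N isT)/eqP|j _]; rewrite ?scale0r //.
  by rewrite oner_eq0.
have fr : free [:: P1; allone_mx] by rewrite free_cons span_seq1 PJ seq1_free.
suff -> : bm_pair e x v = <<[:: P1; allone_mx]>>%VS by move: fr => /eqP.
apply/eqP; rewrite eqEsubv; apply/andP; split; last first.
  by apply/span_subvP => B; rewrite !inE => /orP[] /eqP ->.
apply/subvP => P PM; have := PM.
rewrite mem_bm_pair => /andP[/(bose_mesnerP hdrg x)[bl eP] _].
rewrite {}eP in PM *; move/mem_bm_pair_coef: PM => H.
pose c := bl D - bl D.-1.
(* Downward induction from the last increment [c]: as u_{i+1} is nonzero, each increment is
   determined by the next one. *)
have blS k : (k < D)%N -> bl ((D.-1 - k).+1)%N - bl (D.-1 - k)%N = c * be (D.-1 - k)%N.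
  elim: k => [|k IH] kD; first by rewrite subn0 beD mulr1 prednK //; lia.
  have ek : (D.-1 - k = (D.-1 - k.+1).+1)%N by lia.
  have iD : ((D.-1 - k.+1).+1 < D)%N by lia.
  move: IH; rewrite ek => /(_ (ltnW kD)) IH.
  have := H _ iD; rewrite gP // scalerA IH.
  move/eqP; rewrite -subr_eq0 -scalerBl scaler_eq0 (negbTE (proj1 (chain _ iD))) orbF.
  by rewrite subr_eq0 => /eqP <-; rewrite (beS _ iD) -mulrA [be _ * _]mulrC.
have blE n : (n <= D)%N -> bl n = bl 0%N * 1 + c * al n.
  elim: n => [|n IH] nD; first by rewrite /al big_geq // mulr0 addr0 mulr1.
  have := blS (D.-1 - n)%N; rewrite subKn; last by lia.
  move=> /(_ ltac:(lia)) /(canRL (subrK _)) ->.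
  by rewrite IH ?(ltnW nD) // -(alS n) mulrBr addrC -addrA [c * al n + _]addrC subrK.
have -> : \sum_(j < D.+1) bl j *: A j = bl 0%N *: allone_mx + c *: P1.
  rewrite !scaler_sumr -big_split; apply: eq_bigr => [[j jD]] _ /=.
  by rewrite !scalerA -scalerDl blE.
by rewrite memvD ?memvZ ?memv_span // !inE eqxx ?orbT.
Qed.

Lemma upvec_Tmodule W i : Tmodule e x W -> v \in W -> u i \in W.
Proof.
move=> TW vW; case: i => [|i]; first exact: mem0v.
by apply: (TW _ _ (Estar_terwilliger C e x _));
  apply: (TW _ _ (dist_mx_terwilliger C hdrg x _)).
Qed.

Lemma upvec_chain_of_thin : in_thin_irreducible e x 1 v -> upvec_chain.
Proof.
case=> W [[TW _ _] thW _ vW]; apply: upvec_chain_ind => i iD ui.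
have mem_img h : E i.+1 *m (A h *m v) \in mximg (E i.+1) W.
  by apply/mximgP; exists (A h *m v) => //; apply: (TW _ _ (dist_mx_terwilliger C hdrg x _)).
(* By thinness this level of W is at most a line, and it contains the nonzero u_{i+1}. *)
suff -> : <[u i.+1]>%VS = mximg (E i.+1) W by apply: mem_img.
apply/eqP; rewrite eqEdim -memvE mem_img dim_vline ui ?leqnn //.
exact: thW (ltnW iD).
Qed.

Lemma upspace_irreducible U :
  Tmodule e x U -> (U <= upspace D)%VS -> U = 0%VS \/ U = upspace D.
Proof.
move=> TU UW; have [vU|vU] := boolP (v \in U).
  right; apply/eqP; rewrite eqEsubv UW; apply/subv_sumP => i _.
  by rewrite -memvE upvec_Tmodule.
left; apply/eqP; rewrite -subv0; apply/subvP => w wU.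
(* A submodule missing v meets E_1 V trivially, hence is orthogonal to v,    *)
(* and by self-adjointness to everything v generates.                        *)
have E1U z : z \in U -> E 1 *m z = 0.
  move=> zU; have := Estar_upspace 1 (subvP UW _ zU); rewrite ifT ?upvec1; last by lia.
  case/vlineP => c Ez; rewrite Ez; have := TU _ _ (Estar_terwilliger C e x 1) zU.
  rewrite Ez; have [->|c0] := eqVneq c 0; first by rewrite scale0r.
  by move/(memvZ c^-1); rewrite scalerA mulVf // scale1r (negbTE vU).
have orth i : (i <= D)%N -> forall z, z \in U -> hdot (u i) z = 0.
  case: i => [|i]; first by move=> _ z _; rewrite -[u 0](scale0r 0) hdotZl mul0r.
  elim: i => [|i IH] iD z zU.
    by rewrite upvec1 -Ev hdot_Estar E1U // /hdot map_mx0 mulmx0 mxE.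
  have [c /(_ (ltnW iD)) c0 cu] := adj_upvec i.
  have : hdot (c *: u i.+2) z = 0.
    rewrite -cu hdot_Estar hdot_dist_mx //; apply: IH; first exact: ltnW.
    apply: (TU _ _ (dist_mx_terwilliger C hdrg x _)).
    exact: (TU _ _ (Estar_terwilliger C e x _)).
  by rewrite hdotZl => /eqP; rewrite mulf_eq0 (negbTE c0) => /eqP.
(* Being itself a combination of the u_i, w is orthogonal to itself. *)
rewrite memv0; apply/eqP/hdot_eq0.
have /memv_sumP[f fu eqw] := subvP UW _ wU; rewrite {1}eqw hdot_suml.
apply: big1 => i _; have /vlineP[c ->] := fu i isT.
by rewrite hdotZl orth ?mulr0 // -ltnS.
Qed.

Lemma thin_of_upvec_chain : upvec_chain -> in_thin_irreducible e x 1 v.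
Proof.
move=> chain; have vW : v \in upspace D by rewrite -upvec1 upvec_upspace //; lia.
have H i h : (i <= D)%N -> E i *m (A h *m v) \in <[u i]>%VS.
  case: i => [|i]; first by rewrite Estar0_dist_vec mem0v.
  rewrite leq_eqVlt => /orP[/eqP iD|iD]; apply: Estar_dist_vec_line.
    (* The chain stops below level D, but w_D = 0 because A_{D+1} = 0. *)
    by rewrite /um iD [A D.+1]dist_mx_gt_diam // mul0mx mulmx0 mem0v.
  by case: (chain i iD).
have uD : u D.+1 = 0 by rewrite /= Estar_gt_diam ?mul0mx.
have TW : Tmodule e x (upspace D).
  apply: mxagen_stable => B w; rewrite inE => /orP[/eqP ->|]; first exact: adj_upspace.
  case/mapP => i _ -> /(Estar_upspace i); case: ifP => [iD|_]; last first.
    by rewrite memv0 => /eqP ->; rewrite mem0v.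
  by case/vlineP => c ->; rewrite memvZ ?upvec_upspace.
have img_sub i : (i <= D)%N -> (mximg (E i) (upspace D) <= <[u i]>)%VS.
  move=> iD; apply/subvP => z /mximgP[w /(Estar_upspace i)].
  by rewrite iD => ? ->.
exists (upspace D); split=> //.
- split=> // [W0|U]; last exact: upspace_irreducible.
  by move: vW; rewrite W0 memv0 (negbTE v0).
- move=> i iD; apply: leq_trans (dimvS (img_sub i iD)) _.
  by rewrite dim_vline leq_b1.
have E0 : mximg (E 0) (upspace D) = 0%VS.
  by apply/eqP; rewrite -subv0 (subv_trans (img_sub 0%N isT)) // -memvE mem0v.
have E1 : mximg (E 1) (upspace D) != 0%VS.
  apply: contraNneq v0 => E10; rewrite -memv0 -E10.
  by apply/mximgP; exists v.
rewrite /endpoint; case: (D) hD E0 E1 => // m _ E0 E1.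
by rewrite /= E0 eqxx E1.
Qed.

End EndpointOne.

Theorem theorem1p1 (R : realType) (X : finType) (e : rel X)
    (hdrg : distance_regular e) (hD : (3 <= diam e)%N) (x : X)
    (v : 'cV[R[i]]_#|X|) (hv0 : v <> 0) (hv1 : v \in EstarV R[i] e x 1)
    (hvs : hdot v (svec R[i] e x 1) = 0) :
  ((2 <= \dim (bm_pair e x v))%N <-> in_thin_irreducible e x 1 v) /\
  ((2 <= \dim (bm_pair e x v))%N -> in_thin_irreducible e x 1 v ->
   \dim (bm_pair e x v) = 2%N).
Proof.
move: hv1; rewrite mem_EstarV => /eqP Ev.
(* As v is supported on the neighbours of x, its inner product with s_1 is the sum of its
   entries. *)
have sum_v : \sum_y v (enum_rank y) 0 = 0.
  rewrite -[RHS]hvs /hdot mxE (reindex (@enum_rank X)) /=; last exact/onW_bij/enum_rank_bij.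
  apply: eq_bigr => y _; rewrite !mxE.
  have [->|/(vec_supp Ev) dxy] := eqVneq (v (enum_rank y) 0) 0; first by rewrite mul0r.
  rewrite summxE (bigD1 y) ?dxy //= mxE !eqxx big1 ?addr0 ?rmorph1 ?mulr1 // => z /andP[_ zy].
  by rewrite mxE; case: (_ =P _) => [/enum_rank_inj yz|//]; rewrite yz eqxx in zy.
have v0 : v != 0 by apply/eqP.
have chain_dim := @dim_of_upvec_chain _ _ _ hdrg x v Ev sum_v hD.
have dim_chain := @upvec_chain_of_dim _ _ _ hdrg x v Ev sum_v hD v0.
split; last by move=> dim2 _; exact/chain_dim/dim_chain.
split=> [/dim_chain|].
  exact: thin_of_upvec_chain.
by move=> /(upvec_chain_of_thin hdrg Ev sum_v hD v0)/chain_dim ->.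
Qed.
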